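(* Let $d=p^n$ be a power of a prime, and fix a complete set of $d+1$ mutually unbiased bases $\{|\phi^{(\kappa)}_j\rangle\}_{j=1}^d$, $\kappa=1,\dots,d+1$, of $\mathbb{C}^d$, used to define discrete Wigner functions as described in the context. Let $C_d$ be the H-polytope in probability space consisting of all points $\vec p=(p^{(\kappa)}_j)\in V_d$ for which the discrete Wigner function is non-negative at every phase-space point and for every quantum net obtainable from the fixed set of bases, i.e. such that $$\sum_{\lambda\ni\alpha} p_{Q}(\lambda)\ \ge\ 1$$ for every phase-space point $\alpha$ and every quantum net $Q$ (the sum being over the $d+1$ lines $\lambda$ containing $\alpha$). Let $C_v$ be the V-polytope whose vertices are the $d(d+1)$ points of $V_d$ representing the MUB projectors $\hat P^{(\kappa)}_j=|\phi^{(\kappa)}_j\rangle\langle\phi^{(\kappa)}_j|$, i.e. the convex hull of these points. Then $C_d=C_v$.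
   Context: Phase space. Let $F=GF(d)$. Phase space is $F^2$. A line is the solution set in $F^2$ of an equation $aq+bp=c$ with $a,b,c\in F$ and $(a,b)\neq(0,0)$; each line has $d$ points. A striation is a set of $d$ parallel lines (fixed $(a,b)$ up to scaling, varying $c$). There are $d+1$ striations, labelled $\kappa=1,\dots,d+1$, and through each point there passes exactly one line of each striation. The ray of a striation is its line through the origin. Mutually unbiased bases. The bases are orthonormal and satisfy $|\langle\phi^{(\kappa')}_{j'}|\phi^{(\kappa)}_j\rangle|^2=\frac1d$ for all $j,j'$ whenever $\kappa\ne\kappa'$. Translations. Unitary operators $\hat T_v$ on $\mathbb{C}^d$, $v\in F^2$, are fixed (generalized Pauli operators), which represent phase-space translations: $\hat T_v\hat T_w$ is a scalar multiple of $\hat T_{v+w}$, and $\mathrm{Tr}(\hat T_v^\dagger \hat T_w)=d\,\delta_{v,w}$. Basis $\kappa$ is associated with striation $\kappa$: for every $v$ on the ray of striation $\kappa$, every $|\phi^{(\kappa)}_j\rangle$ is an eigenvector of $\hat T_v$. Quantum nets. A quantum net $Q$ assigns to each line $\lambda$ of each striation $\kappa$ one of the projectors $\hat P^{(\kappa)}_j$, bijectively between the $d$ lines of striation $\kappa$ and the $d$ projectors of basis $\kappa$, and covariantly under translations: $Q(\lambda+v)=\hat T_v\,Q(\lambda)\,\hat T_v^\dagger$ for all lines $\lambda$ and all $v\in F^2$. (For each ray the projector can be chosen arbitrarily in the corresponding basis, and the choices for the rays determine the net, so there are $d^{d+1}$ nets.) Discrete Wigner function. For an operator $\hat\rho$ and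 net $Q$, the Wigner function at the point $\alpha$ is $W_\alpha=\frac1d\left(\sum_{\lambda\ni\alpha}\mathrm{Tr}(\hat\rho\,Q(\lambda))-1\right)$. Probability space. $V_d$ is the $(d^2-1)$-dimensional real affine space of all real arrays $\vec p=(p^{(\kappa)}_j)$, $1\le\kappa\le d+1$, $1\le j\le d$, with $\sum_{j}p^{(\kappa)}_j=1$ for every $\kappa$. A Hermitian operator $\hat\rho$ of unit trace (in particular a density matrix) is represented by the point with $p^{(\kappa)}_j=\mathrm{Tr}(\hat\rho\hat P^{(\kappa)}_j)$; this is a bijection between unit-trace Hermitian operators on $\mathbb{C}^d$ and $V_d$. For $\vec p\in V_d$ and a net $Q$, $p_Q(\lambda)$ denotes $p^{(\kappa)}_j$ where $Q(\lambda)=\hat P^{(\kappa)}_j$; thus the condition $\sum_{\lambda\ni\alpha}p_Q(\lambda)\ge 1$ says exactly $W_\alpha\ge0$ for the net $Q$. *)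

(* Defs.v *)
From HB Require Import structures.
From mathcomp Require Import all_boot all_order all_algebra.
From mathcomp Require Import all_classical all_reals.
From mathcomp Require Import convex.
From mathcomp Require Import complex.

Set Implicit Arguments.
Unset Strict Implicit.
Unset Printing Implicit Defensive.

Import Order.TTheory GRing.Theory Num.Theory.

Local Open Scope ring_scope.

Section PhaseSpace.
Variable F : finFieldType.

(* Points of phase space are pairs (q, p). *)
Definition line (a b c : F) : {set F * F} :=
  [set x : F * F | a * x.1 + b * x.2 == c].

Definition lines : {set {set F * F}} :=
  [set line u.1.1 u.1.2 u.2 | u : F * F * F & u.1 != 0].

Definition striation_of (ab : F * F) : {set {set F * F}} :=
  [set line ab.1 ab.2 c | c : F].

Definition striations : {set {set {set F * F}}} :=
  [set striation_of ab | ab : F * F & ab != 0].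

Definition labels_striations d (S : 'I_d.+1 -> {set {set F * F}}) : Prop :=
  injective S /\ [set S k | k : 'I_d.+1] = striations.

Definition ray (s : {set {set F * F}}) : {set F * F} :=
  (\bigcup_(l in s | (0 : F * F)%R \in l) l)%SET.

Definition translate (l : {set F * F}) (v : F * F) : {set F * F} :=
  [set (x + v)%R | x : F * F in l].

End PhaseSpace.

Local Open Scope classical_set_scope.
Local Open Scope complex_scope.
Local Open Scope sesquilinear_scope.

Section Quantum.
Variables (R : realType) (d : nat).

Definition braket (x y : 'cV[R[i]]_d) : R[i] := (x^t* *m y) 0 0.

Definition complete_mub (phi : 'I_d.+1 -> 'I_d -> 'cV[R[i]]_d) : Prop :=
  (forall k j j', braket (phi k j) (phi k j') = (j == j')%:R) /\
  (forall k k' j j', k != k' ->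
     `|braket (phi k' j') (phi k j)| ^+ 2 = d%:R^-1).

Definition projector (phi : 'I_d.+1 -> 'I_d -> 'cV[R[i]]_d) k j : 'M[R[i]]_d :=
  phi k j *m (phi k j)^t*.

Variable F : finFieldType.

Definition translation_operators (T : F * F -> 'M[R[i]]_d) : Prop :=
  [/\ forall v, T v \is unitarymx,
      forall v w, exists c, T v *m T w = c *: T (v + w)
    & forall v w, \tr ((T v)^t* *m T w) = d%:R * (v == w)%:R].

Definition bases_associated (S : 'I_d.+1 -> {set {set F * F}})
    (T : F * F -> 'M[R[i]]_d) (phi : 'I_d.+1 -> 'I_d -> 'cV[R[i]]_d) : Prop :=
  forall k v j, v \in ray (S k) -> exists c, T v *m phi k j = c *: phi k j.

(* Only the values of a net on lines matter. *)
Definition quantum_net (S : 'I_d.+1 -> {set {set F * F}})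
    (T : F * F -> 'M[R[i]]_d) (phi : 'I_d.+1 -> 'I_d -> 'cV[R[i]]_d)
    (Q : {set F * F} -> 'M[R[i]]_d) : Prop :=
  (forall k, set_bij [set` S k] (range (projector phi k)) Q) /\
  (forall l v, l \in lines F -> Q (translate l v) = T v *m Q l *m (T v)^t*).

Definition wigner (Q : {set F * F} -> 'M[R[i]]_d) (rho : 'M[R[i]]_d)
    (alpha : F * F) : R[i] :=
  d%:R^-1 * (\sum_(l in lines F | alpha \in l) \tr (rho *m Q l) - 1).

(* Row k of an array holds the d numbers attached to the k-th basis. *)
Definition prob_space : set 'M[R]_(d.+1, d) :=
  [set p | forall k, \sum_j p k j = 1].

(* For Hermitian rho the traces are real, so taking real parts loses nothing. *)
Definition prob_point (phi : 'I_d.+1 -> 'I_d -> 'cV[R[i]]_d)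
    (rho : 'M[R[i]]_d) : 'M[R]_(d.+1, d) :=
  \matrix_(k, j) complex.Re (\tr (rho *m projector phi k j)).

(* For a complete set of mutually unbiased bases with d > 1 the projectors are
   pairwise distinct, so on a line the pair (k, j) selected here is unique. *)
Definition net_prob (phi : 'I_d.+1 -> 'I_d -> 'cV[R[i]]_d)
    (Q : {set F * F} -> 'M[R[i]]_d) (p : 'M[R]_(d.+1, d)) (l : {set F * F}) : R :=
  if [pick x : 'I_d.+1 * 'I_d | Q l == projector phi x.1 x.2] is Some x
  then p x.1 x.2 else 0.

Definition C_d (S : 'I_d.+1 -> {set {set F * F}}) (T : F * F -> 'M[R[i]]_d)
    (phi : 'I_d.+1 -> 'I_d -> 'cV[R[i]]_d) : set 'M[R]_(d.+1, d) :=
  [set p | prob_space p /\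
     forall Q, quantum_net S T phi Q -> forall alpha : F * F,
       1 <= \sum_(l in lines F | alpha \in l) net_prob phi Q p l].

Definition convex_hull (E : lmodType R) (A : set E) : set E :=
  smallest (@convex_set R E) A.

Definition C_v (phi : 'I_d.+1 -> 'I_d -> 'cV[R[i]]_d) : set 'M[R]_(d.+1, d) :=
  convex_hull [set prob_point phi (projector phi x.1 x.2)
              | x in [set: 'I_d.+1 * 'I_d]].

Lemma herm_tr_real (A B : 'M[R[i]]_d) : A^t* = A -> B^t* = B ->
  \tr (A *m B) = (complex.Re (\tr (A *m B)))%:C.
Proof.
move=> hA hB; apply: esym; apply: RRe_real; apply/CrealP.
rewrite -[in LHS]mxtrace_tr -[LHS]trace_map_mx trmx_mul map_mxM /= hA hB.
exact: mxtrace_mulC.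
Qed.

Lemma projector_herm (phi : 'I_d.+1 -> 'I_d -> 'cV[R[i]]_d) k j :
  (projector phi k j)^t* = projector phi k j.
Proof. by rewrite /projector trmx_mul map_mxM /= trmxCK. Qed.

(* The inequalities defining C_d express non-negativity of Wigner functions. *)
Lemma wigner_ge0 (S : 'I_d.+1 -> {set {set F * F}}) (T : F * F -> 'M[R[i]]_d)
    (phi : 'I_d.+1 -> 'I_d -> 'cV[R[i]]_d) (Q : {set F * F} -> 'M[R[i]]_d)
    (rho : 'M[R[i]]_d) (alpha : F * F) :
  (0 < d)%N -> labels_striations S -> quantum_net S T phi Q -> rho^t* = rho ->
  (0 <= wigner Q rho alpha) =
  (1 <= \sum_(l in lines F | alpha \in l)
          net_prob phi Q (prob_point phi rho) l).
Proof.
move=> d0 [_ hS] [hQ _] hrho.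
have hl l : l \in lines F ->
    \tr (rho *m Q l) = (net_prob phi Q (prob_point phi rho) l)%:C.
  move=> /imsetP[u]; rewrite inE => u0 ->.
  have : striation_of u.1 \in striations F by apply/imsetP; exists u.1; rewrite ?inE.
  rewrite -hS => /imsetP[k _ ek].
  have : line u.1.1 u.1.2 u.2 \in S k by rewrite -ek; apply/imsetP; exists u.2.
  case: (hQ k) => hf _ _ /hf [j _ ej].
  rewrite /net_prob; case: pickP => [x /eqP -> | /(_ (k, j))]; last first.
    by rewrite /= ej eqxx.
  by rewrite mxE -herm_tr_real ?projector_herm.
rewrite /wigner pmulr_rge0 ?invr_gt0 ?ltr0n // subr_ge0.
rewrite (eq_bigr (fun l => (net_prob phi Q (prob_point phi rho) l)%:C)); last first.
  by move=> l /andP[/hl].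
by rewrite -rmorph_sum -[1]/((1 : R)%:C) lecR.
Qed.

End Quantum.

(* Main.v *)
(** A net may assign to the rays an arbitrary choice of one vector from each
    basis: pick [P k (J k)] for the ray of striation [k] and transport it along
    the translations.  This is a bijection onto basis [k] because the [T v]
    with [v] in the ray are simultaneously diagonal with separating eigenvalues
    and each [T w] commutes with them up to a scalar, while the [T v] with [v]
    outside the ray have zero expectation on basis [k] by unbiasedness.  Hence
    [C_d] is cut out by the inequalities [\sum_k p k (J k) >= 1] over all
    choices [J], that is, by the single condition that the row minima of [p] sum
    to at least [1], and a point satisfying it is an explicit convex combination
    of the vertices. *)

Require Import Defs.
From mathcomp Require Import all_boot all_order all_algebra.
From mathcomp Require Import all_classical all_reals.
From mathcomp Require Import complex.
From mathcomp Require Import interval_inference convex.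
From mathcomp Require Import ring.

Set Implicit Arguments.
Unset Strict Implicit.
Unset Printing Implicit Defensive.

Import Order.TTheory GRing.Theory Num.Theory.

Local Open Scope classical_set_scope.
Local Open Scope ring_scope.
Local Open Scope complex_scope.
Local Open Scope sesquilinear_scope.

(** * Rays and striations *)

Section Geometry.
Variable F : finFieldType.
Implicit Types (a b c t : F) (ab v w x : F * F).

Lemma in_line a b c x : (x \in line a b c) = (a * x.1 + b * x.2 == c).
Proof. by rewrite inE. Qed.

Lemma ray_striation_of ab : ray (striation_of ab) = line ab.1 ab.2 0.
Proof.
apply/setP => x; apply/bigcupP/idP => [[l /andP[/imsetP[c _ ->]]]|xl].
  by rewrite in_line /= !mulr0 addr0 => /eqP <-.
exists (line ab.1 ab.2 0) => //; rewrite in_line /= !mulr0 addr0 eqxx andbT.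
by apply/imsetP; exists 0.
Qed.

Lemma translate_line a b c v :
  translate (line a b c) v = line a b (c + (a * v.1 + b * v.2)).
Proof.
apply/setP => x; rewrite in_line; apply/imsetP/eqP => [[y]|xE].
  by rewrite in_line => /eqP <- -> /=; ring.
exists (x - v); last by rewrite subrK.
rewrite in_line /=; apply/eqP/(addIr (a * v.1 + b * v.2)); rewrite -xE; ring.
Qed.

Lemma line_coef_surj ab c : ab != 0 -> exists v, ab.1 * v.1 + ab.2 * v.2 = c.
Proof.
case: ab => a b ab0 /=; have [a0|a0] := eqVneq a 0.
  exists (0, b^-1 * c); rewrite /= mulr0 add0r mulVKf //.
  by apply: contraNneq ab0 => ->; rewrite a0.
by exists (a^-1 * c, 0); rewrite /= mulr0 addr0 mulVKf.
Qed.

Lemma line_inj ab : ab != 0 -> injective (line ab.1 ab.2).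
Proof.
move=> ab0 c c' e; have [v vE] := line_coef_surj c ab0.
have : v \in line ab.1 ab.2 c by rewrite in_line vE.
by rewrite e in_line vE => /eqP.
Qed.

Lemma striation_of_scale t ab : t != 0 ->
  striation_of (t * ab.1, t * ab.2) = striation_of ab.
Proof.
move=> t0; apply/setP => l; apply/imsetP/imsetP => -[c _ ->] /=.
  exists (t^-1 * c) => //; apply/setP => x; rewrite !in_line.
  by rewrite -!mulrA -mulrDr (can2_eq (mulKf t0) (mulVKf t0)).
exists (t * c) => //; apply/setP => x; rewrite !in_line.
by rewrite -!mulrA -mulrDr (inj_eq (mulfI t0)).
Qed.

(** A direction vector of the second ray lies on the first, so the two coefficient vectors are
    proportional and their striations coincide. *)
Lemma striation_of_ray_inj ab ab' : ab != 0 -> ab' != 0 ->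
  line ab.1 ab.2 0 = line ab'.1 ab'.2 0 -> striation_of ab = striation_of ab'.
Proof.
case: ab ab' => [a b] [a' b'] /= ab0 ab0' e.
have : (b', - a') \in line a b 0 by rewrite e in_line /= mulrN mulrC subrr.
rewrite in_line /= mulrN subr_eq0 => /eqP abE.
suff [t t0 [-> ->]] : exists2 t, t != 0 & a = t * a' /\ b = t * b'.
  exact: (@striation_of_scale t (a', b')).
have [a'0|a'0] := eqVneq a' 0.
  have b'0 : b' != 0 by apply: contraNneq ab0' => ->; rewrite a'0.
  have a0 : a = 0.
    by move/eqP: abE; rewrite a'0 mulr0 mulf_eq0 (negPf b'0) orbF => /eqP.
  exists (b / b'); last by rewrite a0 a'0 mulr0 divfK.
  by rewrite mulf_neq0 ?invr_eq0 //; apply: contraNneq ab0 => ->; rewrite a0.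
have bE : b = a / a' * b' by rewrite mulrAC abE mulfK.
exists (a / a'); last by rewrite divfK.
rewrite mulf_neq0 ?invr_eq0 //; apply: contraNneq ab0 => a0.
by rewrite bE a0 !mul0r.
Qed.

Variables (d : nat) (S : 'I_d.+1 -> {set {set F * F}}).
Hypothesis labS : labels_striations S.
Implicit Types k : 'I_d.+1.

Lemma labelP k : exists2 ab, ab != 0 & S k = striation_of ab.
Proof.
have : S k \in striations F by rewrite -labS.2 imset_f.
by case/imsetP => ab; rewrite inE; exists ab.
Qed.

Lemma label_exists ab : ab != 0 -> exists k, S k = striation_of ab.
Proof.
move=> ab0; have : striation_of ab \in striations F by rewrite imset_f ?inE.
by rewrite -labS.2 => /imsetP[k _ ->]; exists k.
Qed.

Lemma ray0 k : 0 \in ray (S k).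
Proof.
by have [ab _ ->] := labelP k; rewrite ray_striation_of in_line !mulr0 addr0.
Qed.

Lemma rayB k v w : v \in ray (S k) -> w \in ray (S k) -> v - w \in ray (S k).
Proof.
have [ab _ ->] := labelP k; rewrite ray_striation_of !in_line /=.
by move=> /eqP e /eqP e'; apply/eqP; rewrite !mulrBr addrACA -opprD e e' subrr.
Qed.

Lemma rayN k v : (- v \in ray (S k)) = (v \in ray (S k)).
Proof.
have [ab _ ->] := labelP k; rewrite ray_striation_of !in_line /=.
by rewrite !mulrN -opprD oppr_eq0.
Qed.

Lemma ray_inj : injective (fun k => ray (S k)).
Proof.
move=> k k' /= e; apply: labS.1.
have [ab ab0 eS] := labelP k; have [ab' ab0' eS'] := labelP k'.
move: e; rewrite eS eS' !ray_striation_of.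
exact: striation_of_ray_inj.
Qed.

Lemma ray_cover v : exists k, v \in ray (S k).
Proof.
have [->|v0] := eqVneq v 0; first by exists ord0; exact: ray0.
(* The linear form with coefficients [(v.2, - v.1)] vanishes at [v], and is nonzero because [v]
   is. *)
have [|k kE] := @label_exists (v.2, - v.1).
  by apply: contraNneq v0; case: v => a b [-> /eqP]; rewrite oppr_eq0 => /eqP ->.
exists k; rewrite kE ray_striation_of in_line /=; apply/eqP; ring.
Qed.

Lemma mem_translate (l : {set F * F}) v x : (x \in translate l v) = (x - v \in l).
Proof.
apply/imsetP/idP => [[y yl ->]|xl]; first by rewrite addrK.
by exists (x - v) => //; rewrite subrK.
Qed.

Lemma translateD (l : {set F * F}) v w :
  translate (translate l v) w = translate l (v + w).
Proof. by apply/setP => x; rewrite !mem_translate opprD addrA addrAC. Qed.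

Lemma translate_ray_sub k v w : v - w \in ray (S k) ->
  translate (ray (S k)) v = translate (ray (S k)) w.
Proof.
move=> vw; apply/setP => x; rewrite !mem_translate; apply/idP/idP => xr.
  have -> : x - w = (x - v) - (- (v - w)) by rewrite opprK addrA subrK.
  by rewrite rayB // rayN.
have -> : x - v = (x - w) - (v - w) by rewrite opprB addrA subrK.
exact: rayB.
Qed.

(** A line determines its striation, and its base point up to the ray; this makes a net defined from
    base points well defined. *)
Lemma translate_ray_inj k k' v w :
  translate (ray (S k)) v = translate (ray (S k')) w ->
  k = k' /\ v - w \in ray (S k).
Proof.
move=> e; have vw : v - w \in ray (S k').
  by rewrite -mem_translate -e mem_translate subrr ray0.
suff kk : k = k' by rewrite kk.
apply: ray_inj => /=; apply/setP => x.
have /setP/(_ (x + v)) : translate (ray (S k)) v = translate (ray (S k')) v.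
  by rewrite e (translate_ray_sub vw).
by rewrite !mem_translate addrK.
Qed.

Lemma mem_labelP k (l : {set F * F}) :
  reflect (exists v, l = translate (ray (S k)) v) (l \in S k).
Proof.
apply: (iffP idP); have [ab ab0 ->] := labelP k; rewrite ray_striation_of.
  case/imsetP => c _ ->; have [v vE] := line_coef_surj c ab0.
  by exists v; rewrite translate_line vE add0r.
by case=> v ->; rewrite translate_line imset_f.
Qed.

Lemma linesP (l : {set F * F}) :
  reflect (exists k v, l = translate (ray (S k)) v) (l \in lines F).
Proof.
apply: (iffP imsetP) => [[[ab c]]|[k [v]]].
  rewrite inE /= => ab0 ->; have [k kE] := label_exists ab0; exists k.
  by apply/mem_labelP; rewrite kE imset_f.
have [ab ab0 eS] := labelP k; rewrite eS ray_striation_of translate_line => ->.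
by exists (ab, 0 + (ab.1 * v.1 + ab.2 * v.2)); rewrite ?inE.
Qed.

(** Exactly one line of each striation passes through [x], so the lines through [x] are indexed by
    the labels. *)
Lemma sum_lines_through (V : nmodType) (f : {set F * F} -> V) x :
  \sum_(l in lines F | x \in l) f l = \sum_k f (translate (ray (S k)) x).
Proof.
rewrite (reindex_omap (fun k => translate (ray (S k)) x)
  (fun l => [pick k | l == translate (ray (S k)) x])) /=; last first.
  move=> l /andP[/linesP[k [v ->]]]; rewrite mem_translate => xv.
  case: pickP => [k' /eqP -> //|/(_ k)].
  by rewrite -(translate_ray_sub xv) eqxx.
apply: eq_bigl => k; rewrite mem_translate subrr ray0 andbT.
have -> : translate (ray (S k)) x \in lines F by apply/linesP; exists k, x.
case: pickP => [k' /eqP/translate_ray_inj[-> _]|/(_ k)]; last by rewrite eqxx.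
by rewrite eqxx.
Qed.

Lemma ray_enum k : #|F| = d ->
  exists g : 'I_d -> F * F, injective g /\ forall i, g i \in ray (S k).
Proof.
move=> dE; have [[a b] ab0 eS] := labelP k; rewrite eS ray_striation_of /=.
(* Multiples of the direction vector [(b, - a)], which is nonzero, so distinct scalars give distinct
   points. *)
pose h t := (t * b, - (t * a)).
have h_inj : injective h.
  move=> t t' [] /eqP; rewrite -subr_eq0 -mulrBl mulf_eq0 => /orP[|b0 /eqP].
    by rewrite subr_eq0 => /eqP.
  rewrite eqr_opp -subr_eq0 -mulrBl mulf_eq0 => /orP[|a0].
    by rewrite subr_eq0 => /eqP.
  by move: ab0; rewrite (eqP a0) (eqP b0) eqxx.
exists (fun i => h (enum_val (cast_ord (esym dE) i))); split=> [i j|i].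
  by move=> /h_inj/enum_val_inj/cast_ord_inj.
by rewrite in_line /=; apply/eqP; ring.
Qed.

End Geometry.

(** * Rank-one projectors and mutually unbiased bases *)

Lemma zero_unitmx (K : comUnitRingType) n : (0 < n)%N ->
  ((0 : 'M[K]_n) \in unitmx) = false.
Proof. by case: n => // n _; rewrite unitmxE det0 unitr0. Qed.

Section OuterProduct.
Variables (R : realType) (d : nat).
Implicit Types (x y : 'cV[R[i]]_d) (A B M : 'M[R[i]]_d).

Lemma mulmx_braket x y : x^t* *m y = (braket x y)%:M.
Proof. exact: mx11_scalar. Qed.

Lemma mxtrace_outer_mul x A : \tr (x *m x^t* *m A) = braket x (A *m x).
Proof. by rewrite -mulmxA mxtrace_mulC -mulmxA mulmx_braket mxtrace_scalar. Qed.

Lemma braketZr x y (c : R[i]) : braket x (c *: y) = c * braket x y.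
Proof. by rewrite /braket -scalemxAr mxE. Qed.

Lemma braket_conj x y : braket y x = ((braket x y)^*)%R.
Proof.
rewrite /braket !mxE rmorph_sum; apply: eq_bigr => i _.
by rewrite !mxE rmorphM /= conjCK mulrC.
Qed.

Lemma braketZZ x (c : R[i]) : braket (c *: x) (c *: x) = (c * c^*)%R * braket x x.
Proof. by rewrite braketZr braket_conj braketZr rmorphM /= -braket_conj mulrA. Qed.

Lemma outerZ x (c : R[i]) : (c *: x) *m (c *: x)^t* = (c * c^*)%R *: (x *m x^t*).
Proof. by rewrite linearZ map_mxZ -scalemxAl -scalemxAr scalerA. Qed.

Lemma outer_unitZ x (c : R[i]) : braket x x = 1 ->
  braket (c *: x) (c *: x) = 1 -> (c *: x) *m (c *: x)^t* = x *m x^t*.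
Proof. by rewrite braketZZ => -> ; rewrite mulr1 outerZ => ->; rewrite scale1r. Qed.

Lemma outer_mul A x : A *m (x *m x^t*) *m A^t* = (A *m x) *m (A *m x)^t*.
Proof. by rewrite trmx_mul map_mxM !mulmxA. Qed.

Lemma braket_adj A x y : braket x (A^t* *m y) = braket (A *m x) y.
Proof. by rewrite /braket trmx_mul map_mxM mulmxA. Qed.

Lemma unitary_trC_mul A : A \is unitarymx -> A^t* *m A = 1%:M.
Proof. by move=> /unitarymxP/mulmx1C. Qed.

Lemma braket_unitary A x y : A \is unitarymx ->
  braket (A *m x) (A *m y) = braket x y.
Proof.
move=> hA; rewrite /braket trmx_mul map_mxM mulmxA -(mulmxA _ _ A).
by rewrite unitary_trC_mul // mulmx1.
Qed.

(** Unitarity of both matrices forces [c] to have modulus one, as one diagonal entry of the identity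
    shows; conjugation therefore does not see phases. *)
Lemma unitaryZ_conj A B M (c : R[i]) : (0 < d)%N ->
    A \is unitarymx -> B \is unitarymx -> A = c *: B ->
  A *m M *m A^t* = B *m M *m B^t*.
Proof.
move=> d0 /unitarymxP hA /unitarymxP hB e.
have Z (N : 'M_d) : A *m N *m A^t* = (c * c^*)%R *: (B *m N *m B^t*).
  by rewrite e linearZ map_mxZ -!scalemxAl -scalemxAr scalerA.
suff c1 : (c * c^*)%R = 1 by rewrite Z c1 scale1r.
have := Z 1%:M; rewrite !mulmx1 hA hB => /matrixP/(_ (Ordinal d0) (Ordinal d0)).
by rewrite !mxE eqxx !mulr1n mulr1.
Qed.

End OuterProduct.

Section MUB.
Variables (R : realType) (d : nat) (phi : 'I_d.+1 -> 'I_d -> 'cV[R[i]]_d).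
Hypothesis mub : complete_mub phi.
Implicit Types (k : 'I_d.+1) (i j : 'I_d).
Local Notation P := (projector phi).

Lemma braket_same k i j : braket (phi k i) (phi k j) = (i == j)%:R.
Proof. exact: mub.1. Qed.

Lemma projectorM k (A : 'M_d) i j :
  P k i *m A *m P k j = braket (phi k i) (A *m phi k j) *: (phi k i *m (phi k j)^t*).
Proof.
rewrite /projector -!mulmxA (mulmxA A) (mulmxA _ (A *m _)) mulmx_braket.
by rewrite mul_scalar_mx -scalemxAr.
Qed.

Lemma projector_mul k j (x : 'cV_d) : P k j *m x = braket (phi k j) x *: phi k j.
Proof. by rewrite /projector -mulmxA mulmx_braket mul_mx_scalar. Qed.

(** The square matrix [B] with columns [phi k j] has its adjoint as a left inverse, hence also as a
    right inverse. *)
Lemma projector_complete k : \sum_j P k j = 1%:M.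
Proof.
pose B : 'M[R[i]]_d := \matrix_(a, j) phi k j a 0.
have colB j : col j B = phi k j by apply/colP => a; rewrite !mxE.
have /mulmx1C <- : B^t* *m B = 1%:M.
  apply/matrixP => i j; rewrite [RHS]mxE -(braket_same k i j) /braket !mxE.
  by apply: eq_bigr => a _; rewrite !mxE.
apply/matrixP => a b; rewrite summxE mxE; apply: eq_bigr => j _.
by rewrite !mxE big_ord1 !mxE.
Qed.

Lemma braket_expand k (x : 'cV_d) : x = \sum_j braket (phi k j) x *: phi k j.
Proof.
rewrite -{1}(mul1mx x) -(projector_complete k) mulmx_suml.
by apply: eq_bigr => j _; rewrite projector_mul.
Qed.

Lemma mxtrace_projector k j : \tr (P k j) = 1.
Proof. by rewrite -(mulmx1 (P k j)) mxtrace_outer_mul mul1mx braket_same eqxx. Qed.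

Lemma mxtrace_projectorM k k' j j' :
  \tr (P k j *m P k' j') = if k == k' then (j == j')%:R else d%:R^-1.
Proof.
rewrite mxtrace_outer_mul projector_mul braketZr braket_conj mulrC -normCK.
have [<-|kk] := eqVneq k k'; last by rewrite mub.2 // eq_sym.
by rewrite braket_same normr_nat eq_sym; case: eqP; rewrite ?expr1n ?expr0n.
Qed.

(** The trace of a product of two projectors is 1 when they coincide, and otherwise 0 or the inverse
    of [d], which differs from 1 since [d > 1]. *)
Lemma projector_inj k k' j j' : (1 < d)%N -> P k j = P k' j' -> (k, j) = (k', j').
Proof.
move=> d1 e; have := mxtrace_projectorM k k' j j'.
rewrite -e mxtrace_projectorM eqxx.
have [<-|_] := eqVneq k k'; rewrite eqxx.
  by have [<-//|_ /eqP] := eqVneq j j'; rewrite oner_eq0.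
move/eqP; rewrite eq_sym invr_eq1 -[1]/(1%:R) eqr_nat => /eqP d1'.
by rewrite d1' in d1.
Qed.

End MUB.

(** * Translations acting on the bases *)

Section TranslationAction.
Variables (R : realType) (d : nat) (F : finFieldType).
Variables (S : 'I_d.+1 -> {set {set F * F}}) (T : F * F -> 'M[R[i]]_d).
Variable phi : 'I_d.+1 -> 'I_d -> 'cV[R[i]]_d.
Hypotheses (cardF : #|F| = d) (labS : labels_striations S).
Hypotheses (transT : translation_operators T) (mub : complete_mub phi).
Hypothesis assoc : bases_associated S T phi.
Implicit Types (k : 'I_d.+1) (i j : 'I_d) (u v w : F * F).
Local Notation P := (projector phi).
Local Notation conjT v M := (T v *m M *m (T v)^t*).

Let d_gt1 : (1 < d)%N. Proof. by rewrite -cardF card_finNzRing_gt1. Qed.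
Let d_gt0 : (0 < d)%N. Proof. exact: ltnW. Qed.

Let T_unitary v : T v \is unitarymx. Proof. by have [] := transT. Qed.

Lemma translation_mul v w : exists2 c, c != 0 & T v *m T w = c *: T (v + w).
Proof.
have [_ /(_ v w)[c cE] _] := transT; exists c => //; apply/negP => /eqP c0.
have : T v *m T w \in unitmx by rewrite unitmx_mul !unitarymx_unit.
by rewrite cE c0 scale0r zero_unitmx.
Qed.

(** The operators compose only up to a scalar, but conjugation by them is a genuine action of the
    group of translations. *)
Lemma translation_conjD v w (M : 'M_d) : conjT v (conjT w M) = conjT (v + w) M.
Proof.
have [c _ cE] := translation_mul v w.
rewrite -(unitaryZ_conj M d_gt0 _ (T_unitary _) cE) ?mul_unitarymx //.
by rewrite trmx_mul map_mxM !mulmxA.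
Qed.

Lemma translation_commute v w : exists c, T v *m T w = c *: (T w *m T v).
Proof.
have [b b0 bE] := translation_mul w v; have [a _ aE] := translation_mul v w.
by exists (a / b); rewrite bE aE addrC scalerA divfK.
Qed.

Lemma translation0 : exists c, T 0 = c%:M.
Proof.
have [c _] := translation_mul 0 0; rewrite addr0 => cE; exists c.
rewrite -(mulmxK (unitarymx_unit (T_unitary 0)) (T 0)) cE -scalemxAl.
by rewrite mulmxV ?unitarymx_unit // scalemx1.
Qed.

(** Trace orthogonality of [T v] to [T 0], which is a nonzero scalar matrix. *)
Lemma mxtrace_translation v : v != 0 -> \tr (T v) = 0.
Proof.
move=> v0; have [c cE] := translation0; have [_ _ /(_ 0 v)] := transT.
rewrite eq_sym (negPf v0) mulr0 cE tr_scalar_mx map_scalar_mx mul_scalar_mx.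
rewrite mxtraceZ => /eqP; rewrite mulf_eq0 conjC_eq0 => /orP[/eqP c0|/eqP //].
move: (unitarymx_unit (T_unitary 0)).
by rewrite cE c0 -scalemx1 scale0r zero_unitmx.
Qed.

Lemma translation_conj_projector v k j : conjT v (P k j) =
  (T v *m phi k j) *m (T v *m phi k j)^t*.
Proof. exact: outer_mul. Qed.

Lemma braket_translation v k j : braket (T v *m phi k j) (T v *m phi k j) = 1.
Proof. by rewrite braket_unitary // braket_same // eqxx. Qed.

Lemma translation_projector k j v (x : 'cV_d) (c : R[i]) :
  T v *m x = c *: phi k j -> braket x x = 1 ->
  conjT v (x *m x^t*) = P k j.
Proof.
move=> e x1; rewrite outer_mul e outer_unitZ ?braket_same ?eqxx //.
by rewrite -e braket_unitary.
Qed.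

Lemma translation_ray_conj k j v : v \in ray (S k) -> conjT v (P k j) = P k j.
Proof.
by case/(assoc j) => c cE; apply: translation_projector cE _; rewrite braket_same ?eqxx.
Qed.

(** Written as an expectation value to be total; it is an eigenvalue of [T v] when [v] lies on the
    ray of [S k]. *)
Definition ray_eigenvalue k v j : R[i] := braket (phi k j) (T v *m phi k j).

Lemma ray_eigenvalueE k v j : v \in ray (S k) ->
  T v *m phi k j = ray_eigenvalue k v j *: phi k j.
Proof.
case/(assoc j) => c cE; rewrite /ray_eigenvalue cE braketZr braket_same //.
by rewrite eqxx mulr1.
Qed.

Lemma ray_diagonal k v : v \in ray (S k) ->
  T v = \sum_j ray_eigenvalue k v j *: P k j.
Proof.
move=> vk; rewrite -{1}(mulmx1 (T v)) -(projector_complete mub k) mulmx_sumr.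
by apply: eq_bigr => j _; rewrite mulmxA ray_eigenvalueE // scalemxAl.
Qed.

(* [T v] is traceless and diagonal in another basis, where [P k j] has constant
   diagonal by unbiasedness. *)
Lemma mxtrace_projector_translation k j v : v \notin ray (S k) ->
  \tr (P k j *m T v) = 0.
Proof.
move=> vk; have v0 : v != 0 by apply: contraNneq vk => ->; apply: ray0.
have [k' vk'] := ray_cover labS v.
have kk' : k != k' by apply: contraNneq vk => ->.
have := mxtrace_translation v0; rewrite (ray_diagonal vk') mulmx_sumr !linear_sum /=.
under eq_bigr do rewrite mxtraceZ mxtrace_projector // mulr1.
under [in X in _ -> X]eq_bigr do
  rewrite -scalemxAr mxtraceZ mxtrace_projectorM // (negPf kk').
by rewrite -mulr_suml => ->; rewrite mul0r.
Qed.

(** If [v] were off the ray, the compression of [T v] by [P k j] would vanish; as the two commute,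
    [T v *m P k j] would be zero, and so would [P k j], whose trace is 1. *)
Lemma translation_conj_eq k j v : conjT v (P k j) = P k j -> v \in ray (S k).
Proof.
move=> e; apply: contraTT isT => vk.
have com : P k j *m T v = T v *m P k j.
  by rewrite -[in LHS]e -mulmxA unitary_trC_mul // mulmx1.
have PP : P k j *m P k j = P k j.
  by rewrite -{1}(mulmx1 (P k j)) projectorM mul1mx braket_same // eqxx scale1r.
have P0 : P k j *m T v *m P k j = 0.
  by rewrite projectorM -mxtrace_outer_mul mxtrace_projector_translation ?scale0r.
have : T v *m P k j = T v *m 0 by rewrite mulmx0 -P0 com -mulmxA PP.
move/(can_inj (mulKmx (unitarymx_unit (T_unitary v)))) => P00.
have := mxtrace_projector mub k j.
by rewrite P00 mxtrace0 => /eqP; rewrite eq_sym oner_eq0.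
Qed.

(* The [d] translations along a ray are orthogonal for the trace, so their
   matrix of eigenvalues is unitary up to scaling and has distinct columns. *)
Lemma ray_eigenvalue_separate k i i' :
  (forall v, v \in ray (S k) -> ray_eigenvalue k v i = ray_eigenvalue k v i') ->
  i = i'.
Proof.
move=> eqi; have [g [g_inj gk]] := ray_enum labS k cardF.
pose E : 'M[R[i]]_d := \matrix_(t, j) ray_eigenvalue k (g t) j.
pose E' : 'M[R[i]]_d := d%:R^-1 *: E^t*.
have d0 : d%:R != 0 :> R[i] by rewrite pnatr_eq0 -lt0n.
have /mulmx1C/matrixP E'E : E *m E' = 1%:M.
  apply/matrixP => t t'; rewrite -scalemxAr !mxE eq_sym -(inj_eq g_inj).
  apply/(mulfI d0); rewrite mulVKf //; have [_ _ <-] := transT.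
  rewrite (ray_diagonal (gk t)) mulmx_sumr linear_sum; apply: eq_bigr => j _ /=.
  rewrite !mxE -scalemxAr mxtraceZ; congr (_ * _).
  by rewrite mxtrace_mulC mxtrace_outer_mul braket_adj braket_conj.
(* Columns [i] and [i'] of [E] agree, so the entries [(i', i)] and [(i', i')] of the identity
   agree. *)
have := E'E i' i; have -> : (E' *m E) i' i = (E' *m E) i' i'.
  by rewrite !mxE; apply: eq_bigr => t _; congr (_ * _); rewrite !mxE eqi.
rewrite E'E !mxE eqxx; have [//|_ /eqP] := eqVneq i' i.
by rewrite oner_eq0.
Qed.

(* [T v] commutes up to scalars with the translations along the ray, so
   [T v *m phi k j] is again a joint eigenvector of them. *)
Lemma translation_permutes k j v : exists i, conjT v (P k j) = P k i.
Proof.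
set x := T v *m phi k j; have x1 : braket x x = 1 by rewrite braket_translation.
(* At most one coefficient of [x] is nonzero: every basis vector overlapping [x] has the eigenvalues
   of [x] along the ray, and these separate the basis. *)
have same i i' : braket (phi k i) x != 0 -> braket (phi k i') x != 0 -> i = i'.
  move=> xi xi'; apply: (@ray_eigenvalue_separate k) => w wk.
  have [c cE] := translation_commute w v.
  have wx : T w *m x = (c * ray_eigenvalue k w j) *: x.
    rewrite /x mulmxA cE -scalemxAl -mulmxA (ray_eigenvalueE _ wk).
    by rewrite -scalemxAr scalerA.
  have eigen l : braket (phi k l) x != 0 ->
      ray_eigenvalue k w l = c * ray_eigenvalue k w j.
    move=> xl; apply/(mulIf xl); rewrite -[RHS]braketZr -wx.
    rewrite {2}(braket_expand mub k x) mulmx_sumr.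
    rewrite (eq_bigr (fun l => (braket (phi k l) x * ray_eigenvalue k w l) *: phi k l)).
      rewrite /braket mulmx_sumr summxE (bigD1 l) //= big1 ?addr0.
        by rewrite -[X in _ = X]/(braket _ _) braketZr braket_same // eqxx mulr1 mulrC.
      move=> m ml; rewrite -[LHS]/(braket _ _) braketZr braket_same // eq_sym (negPf ml).
      by rewrite mulr0.
    by move=> m _; rewrite -scalemxAr (ray_eigenvalueE m wk) scalerA.
  by rewrite (eigen _ xi) (eigen _ xi').
have [i xi] : exists i, braket (phi k i) x != 0.
  apply/existsP; apply: contraPT x1 => /existsPn x0.
  rewrite (braket_expand mub k x) big1 => [|i _].
    by rewrite /braket mulmx0 mxE => /eqP; rewrite eq_sym oner_eq0.
  by move/negPn/eqP: (x0 i) => ->; rewrite scale0r.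
exists i; rewrite translation_conj_projector -/x.
have xE : x = braket (phi k i) x *: phi k i.
  rewrite {1}(braket_expand mub k x) (bigD1 i) //= big1 ?addr0 // => i' i'i.
  have [->|xi'] := eqVneq (braket (phi k i') x) 0; first by rewrite scale0r.
  by rewrite (same _ _ xi xi') eqxx in i'i.
by rewrite xE outer_unitZ -?xE // braket_same // eqxx.
Qed.

End TranslationAction.

(** * Quantum nets *)

Section Nets.
Variables (R : realType) (d : nat) (F : finFieldType).
Variables (S : 'I_d.+1 -> {set {set F * F}}) (T : F * F -> 'M[R[i]]_d).
Variable phi : 'I_d.+1 -> 'I_d -> 'cV[R[i]]_d.
Hypotheses (cardF : #|F| = d) (labS : labels_striations S).
Hypotheses (transT : translation_operators T) (mub : complete_mub phi).
Hypothesis assoc : bases_associated S T phi.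
Implicit Types (k : 'I_d.+1) (j : 'I_d) (v w : F * F) (l : {set F * F}).
Implicit Types (J : 'I_d.+1 -> 'I_d) (p : 'M[R]_(d.+1, d)).
Local Notation P := (projector phi).
Local Notation conjT v M := (T v *m M *m (T v)^t*).

(** The line is written as a translated ray by an arbitrary choice of base point; [ray_netE] shows
    that the value does not depend on it. The default 0 is reached only off the lines. *)
Definition ray_net J l : 'M[R[i]]_d :=
  if [pick x : 'I_d.+1 * (F * F) | l == translate (ray (S x.1)) x.2] is Some x
  then conjT x.2 (P x.1 (J x.1)) else 0.

Lemma ray_netE J k v :
  ray_net J (translate (ray (S k)) v) = conjT v (P k (J k)).
Proof.
rewrite /ray_net; case: pickP => [[k' w] /=|/(_ (k, v))]; last by rewrite eqxx.
move=> /eqP/(translate_ray_inj labS)[<- vw].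
rewrite -{1}(translation_ray_conj transT mub assoc (J k) vw).
by rewrite (translation_conjD cardF transT) addrC subrK.
Qed.

(** Undoing one of the two conjugations leaves a translation fixing [P k (J k)], which therefore
    lies on the ray. *)
Lemma ray_net_inj J k : {in S k &, injective (ray_net J)}.
Proof.
move=> _ _ /(mem_labelP labS)[v ->] /(mem_labelP labS)[w ->].
rewrite !ray_netE => e; apply: translate_ray_sub => //.
rewrite -(rayN labS) opprB.
apply: (translation_conj_eq cardF labS transT mub assoc (j := J k)).
have /(congr1 (fun M => conjT (- v) M)) := e.
rewrite !(translation_conjD cardF transT) addNr addrC => <-.
by rewrite (translation_ray_conj transT mub assoc) // ray0.
Qed.

Lemma ray_net_quantum J : quantum_net S T phi (ray_net J).
Proof.
split=> [k|l v /(linesP labS)[k [w ->]]]; last first.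
  by rewrite translateD !ray_netE (translation_conjD cardF transT) addrC.
have im l : l \in S k -> exists i, ray_net J l = P k i.
  move=> /(mem_labelP labS)[v ->]; rewrite ray_netE.
  exact: (translation_permutes cardF labS transT mub assoc).
split=> [l /= /im[i ->]|l l'|]; first by exists i.
  by rewrite !inE /=; apply: ray_net_inj.
(* Surjectivity by counting: the lines of the striation are indexed by [c : F], and the induced map
   [h] from [F] to ['I_d] is injective between sets of equal size. *)
have [ab ab0 eS] := labelP labS k.
have lineS c : line ab.1 ab.2 c \in S k by rewrite eS imset_f.
have [h hE] := choice (fun c => im _ (lineS c)).
have h_inj : injective h.
  move=> c c' e; apply: (line_inj ab0); apply: (ray_net_inj (J := J)) (lineS c) (lineS c') _.
  by rewrite !hE e.
have [|h' _ hK] := inj_card_bij h_inj; first by rewrite card_ord cardF.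
by move=> _ [j _ <-]; exists (line ab.1 ab.2 (h' j)); rewrite /= ?lineS // hE hK.
Qed.

Lemma net_probE Q p l k j : Q l = P k j -> net_prob phi Q p l = p k j.
Proof.
rewrite /net_prob => QE; case: pickP => [[k' j'] /eqP|/(_ (k, j))]; last first.
  by rewrite QE eqxx.
have d_gt1 : (1 < d)%N by rewrite -cardF card_finNzRing_gt1.
by rewrite QE => /(projector_inj mub d_gt1)[-> ->].
Qed.

Lemma C_dP p : C_d S T phi p <->
  prob_space p /\ forall J, 1 <= \sum_k p k (J k).
Proof.
split=> -[pV pJ]; split=> //.
  (* At the origin the lines are the rays themselves, to which [ray_net J] assigns the projectors
     [P k (J k)]. *)
  move=> J; have := pJ _ (ray_net_quantum J) 0; rewrite (sum_lines_through labS).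
  congr (1 <= _); apply: eq_bigr => k _; apply: net_probE; rewrite ray_netE.
  by rewrite (translation_ray_conj transT mub assoc) // ray0.
move=> Q [Qbij _] x.
rewrite (sum_lines_through labS).
(* Conversely, the lines through [x] select one projector from each basis, that is, some choice
   [J]. *)
have im k : exists j, Q (translate (ray (S k)) x) = P k j.
  have [Qf _ _] := Qbij k; have [|j _ <-] := Qf (translate (ray (S k)) x).
    by apply/(mem_labelP labS); exists x.
  by exists j.
have [J QJ] := choice im; under eq_bigr do rewrite (net_probE _ (QJ _)).
exact: pJ.
Qed.

End Nets.

(** * Convex combinations *)

Section ConvexCombination.
Variables (R : realType) (E : lmodType R) (A : set E).
Hypothesis convexA : @convex_set R E A.

(** Stating the claim for unnormalized weights of positive total lets the induction pass to the tail
    of the sequence without rescaling. *)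
Lemma convex_set_sum (I : eqType) (s : seq I) (w : I -> R) (x : I -> E) :
  (forall i, 0 <= w i) -> (forall i, A (x i)) ->
  0 < \sum_(i <- s) w i ->
  A ((\sum_(i <- s) w i)^-1 *: \sum_(i <- s) w i *: x i).
Proof.
move=> w0 xA; elim: s => [|i s IHs]; first by rewrite big_nil ltxx.
rewrite !big_cons; set W := \sum_(j <- s) w j; set X := \sum_(j <- s) _ => W0.
have Wge0 : 0 <= W by apply: sumr_ge0.
(* A tail of total weight zero cannot be normalized, but all its terms vanish and only [x i]
   remains. *)
have [W00|Wn0] := eqVneq W 0.
  have -> : X = 0.
    rewrite /X big_seq big1 // => j js.
    move/eqP: W00; rewrite psumr_eq0 // => /allP/(_ j js)/eqP ->.
    by rewrite scale0r.
  rewrite W00 !addr0 scalerA mulVf ?scale1r //.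
  by move: W0; rewrite W00 addr0 => /lt0r_neq0.
have WA : A (W^-1 *: X) by apply: IHs; rewrite lt_def Wn0.
have t0 : 0 <= w i / (w i + W) by rewrite divr_ge0 // ltW.
have t1 : w i / (w i + W) <= 1 by rewrite ler_pdivrMr // mul1r lerDl.
have := convexA (Itv01 t0 t1) (mem_set (xA i)) (mem_set WA).
move/set_mem; congr (A _).
rewrite -[LHS]/(w i / (w i + W) *: x i + (1 - w i / (w i + W)) *: (W^-1 *: X)).
rewrite scalerDr !scalerA mulrC; congr (_ + _ *: _).
by field; rewrite Wn0 lt0r_neq0.
Qed.

Lemma convex_set_sum1 (I : finType) (w : I -> R) (x : I -> E) :
  (forall i, 0 <= w i) -> \sum_i w i = 1 -> (forall i, A (x i)) ->
  A (\sum_i w i *: x i).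
Proof.
move=> w0 w1 xA; have := @convex_set_sum I (index_enum I) w x w0 xA.
by rewrite w1 invr1 scale1r; apply; rewrite ltr01.
Qed.

End ConvexCombination.

(** * The polytope spanned by the vertices *)

Section Polytope.
Variables (R : realType) (d : nat).
Hypothesis d_gt0 : (0 < d)%N.
Implicit Types (k : 'I_d.+1) (j : 'I_d) (p : 'M[R]_(d.+1, d)).
Implicit Types J : 'I_d.+1 -> 'I_d.

(** The probability array of [P k j]: a point mass in its own row, and uniform in the others by
    unbiasedness (see [prob_point_projector]). *)
Definition mub_vertex k j : 'M[R]_(d.+1, d) :=
  \matrix_(k', j') if k == k' then (j == j')%:R else d%:R^-1.

Let dn0 : d%:R != 0 :> R. Proof. by rewrite pnatr_eq0 -lt0n. Qed.

Let sum_inv n : \sum_(i < n) d%:R^-1 = n%:R / d%:R :> R.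
Proof. by rewrite sumr_const card_ord mulr_natl. Qed.

Lemma mub_vertex_prob k j : prob_space (mub_vertex k j).
Proof.
move=> k'; under eq_bigr do rewrite mxE; case: eqP => _.
  by rewrite (bigD1 j) //= eqxx big1 ?addr0 // => i; rewrite eq_sym => /negPf ->.
by rewrite sum_inv divff.
Qed.

(** The [d] rows other than [k] already contribute 1 in total, and row [k] contributes 0 or 1. *)
Lemma mub_vertex_ge k j J : 1 <= \sum_k' mub_vertex k j k' (J k').
Proof.
rewrite (bigD1 k) //= mxE eqxx.
rewrite (eq_bigr (fun=> d%:R^-1)); last by move=> i ik; rewrite mxE eq_sym (negPf ik).
rewrite sumr_const cardC1 card_ord /= -[_ *+ d]mulr_natl mulfV //.
by rewrite lerDr ler0n.
Qed.

Definition excess p J : R := \sum_k p k (J k) - 1.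

(* Subtracting the row minima [p k (J k)] makes the weights nonnegative; the
   slack of the inequality for [J] is then put on an arbitrary row. *)
Definition vertex_weight p J k j : R :=
  p k j - p k (J k) + (if k == ord0 then excess p J else 0).

Lemma sum_vertex_weight p J k : prob_space p ->
  \sum_j vertex_weight p J k j =
  1 - d%:R * p k (J k) + (if k == ord0 then d%:R * excess p J else 0).
Proof.
move=> pV; rewrite big_split /= sumrB pV !sumr_const card_ord !mulr_natl.
by case: ifP => _; rewrite ?mul0rn.
Qed.

Lemma sum2_vertex_weight p J : prob_space p ->
  \sum_k \sum_j vertex_weight p J k j = 1.
Proof.
move=> pV; under eq_bigr do rewrite sum_vertex_weight //.
rewrite big_split /= sumrB sumr_const card_ord -mulr_sumr -big_mkcond big_pred1_eq.
by rewrite /excess -natr1; ring.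
Qed.

(** At entry [(k', j')], row [k'] contributes only the weight of its own vertex, and all other rows
    together contribute their total weight divided by [d]. The latter is [p k' (J k')], less the
    excess in row [ord0], which restores [p k' j']. *)
Lemma vertex_combination p J : prob_space p ->
  \sum_k \sum_j vertex_weight p J k j *: mub_vertex k j = p.
Proof.
move=> pV; apply/matrixP => k' j'; rewrite summxE.
under eq_bigr do rewrite summxE.
rewrite (bigD1 k') //= (bigD1 j') //= big1 ?addr0; last first.
  by move=> j /negPf jj'; rewrite !mxE eqxx jj' mulr0.
rewrite !mxE !eqxx mulr1 (eq_bigr (fun k =>
    (\sum_j vertex_weight p J k j) * d%:R^-1)); last first.
  move=> k /negPf kk'; rewrite mulr_suml; apply: eq_bigr => j _.
  by rewrite !mxE kk'.
rewrite -mulr_suml; have := sum2_vertex_weight J pV; rewrite (bigD1 k') //=.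
rewrite sum_vertex_weight // => /(canRL (addKr _)) ->.
by rewrite /vertex_weight; case: eqP => _; field.
Qed.

Lemma vertex_hullP p : prob_space p ->
  (forall J, 1 <= \sum_k p k (J k)) ->
  convex_hull [set mub_vertex x.1 x.2 | x in [set: 'I_d.+1 * 'I_d]] p.
Proof.
move=> pV pJ A [cA sA].
(* Choosing row minima makes every difference in the weights nonnegative, and the inequality for
   this [J] makes the excess nonnegative. *)
pose J k := [arg min_(j < Ordinal d_gt0) p k j]%O.
have Jmin k j : p k (J k) <= p k j.
  by rewrite /J; case: arg_minP => // i _; apply.
rewrite -(vertex_combination J pV) pair_bigA /=.
apply: (@convex_set_sum1 R _ A cA _ (fun x => vertex_weight p J x.1 x.2)).
- move=> [k j] /=; rewrite addr_ge0 ?subr_ge0 //.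
  by case: ifP => // _; rewrite subr_ge0.
- by rewrite -(pair_bigA _ (vertex_weight p J)) sum2_vertex_weight.
- by move=> x; apply: sA; exists x.
Qed.

End Polytope.

(** * The MUB projectors as vertices, convexity of [C_d], and the two inclusions *)

Lemma prob_point_projector (R : realType) (d : nat)
    (phi : 'I_d.+1 -> 'I_d -> 'cV[R[i]]_d) k j : complete_mub phi ->
  prob_point phi (projector phi k j) = mub_vertex R k j.
Proof.
move=> mub; apply/matrixP => k' j'; rewrite !mxE mxtrace_projectorM //.
have natC n : (n%:R : R[i]) = (n%:R)%:C by rewrite rmorph_nat.
by case: eqP => _; rewrite natC // -fmorphV.
Qed.

Lemma convex_C_d (R : realType) (d : nat) (F : finFieldType)
    (S : 'I_d.+1 -> {set {set F * F}}) (T : F * F -> 'M[R[i]]_d)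
    (phi : 'I_d.+1 -> 'I_d -> 'cV[R[i]]_d) :
  #|F| = d -> labels_striations S -> translation_operators T ->
  complete_mub phi -> bases_associated S T phi ->
  @convex_set R 'M[R]_(d.+1, d) (C_d S T phi).
Proof.
move=> cardF labS transT mub assoc p q t /set_mem.
move=> /(C_dP cardF labS transT mub assoc)[pV pJ] /set_mem.
move=> /(C_dP cardF labS transT mub assoc)[qV qJ]; apply: mem_set.
have convE k j : (conv t p q : 'M_(_, _)) k j =
  t%:num * p k j + (1 - t%:num) * q k j by rewrite !mxE.
apply/(C_dP cardF labS transT mub assoc); split=> [k|J].
  under eq_bigr do rewrite convE.
  by rewrite big_split /= -!mulr_sumr pV qV !mulr1 addrC subrK.
under eq_bigr do rewrite convE.
rewrite big_split /= -!mulr_sumr -[X in X <= _](subrK t%:num) addrC.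
by rewrite lerD // ler_peMr // subr_ge0.
Qed.

Theorem theorem1 (R : realType) (d p n : nat) (F : finFieldType)
    (S : 'I_d.+1 -> {set {set F * F}}) (T : F * F -> 'M[R[i]]_d)
    (phi : 'I_d.+1 -> 'I_d -> 'cV[R[i]]_d) :
  prime p -> (0 < n)%N -> d = (p ^ n)%N -> #|F| = d ->
  labels_striations S ->
  translation_operators T ->
  complete_mub phi ->
  bases_associated S T phi ->
  C_d S T phi = C_v phi.
Proof.
move=> _ _ _ cardF labS transT mub assoc.
have d_gt0 : (0 < d)%N by rewrite -cardF ltnW ?card_finNzRing_gt1.
have VE : [set prob_point phi (projector phi x.1 x.2) | x in [set: 'I_d.+1 * 'I_d]]
    = [set mub_vertex R x.1 x.2 | x in [set: 'I_d.+1 * 'I_d]].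
  by apply: eq_imagel => x _; apply: prob_point_projector.
rewrite /C_v VE; apply/seteqP; split=> [q|].
  by move=> /(C_dP cardF labS transT mub assoc)[]; apply: vertex_hullP.
(* The hull is the smallest convex set containing the vertices, so convexity of [C_d] leaves only
   the vertices to check. *)
apply: smallest_sub; first exact: convex_C_d.
move=> _ [[k j] _ <-]; apply/(C_dP cardF labS transT mub assoc); split.
  exact: mub_vertex_prob.
by move=> J; apply: mub_vertex_ge.
Qed.
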